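(* Let $G$ and $H$ be undirected simple graphs on $N=\{1,\dots,n\}$ such that for every non-edge $kl$ of $G$ there is at most one path $p$ in $H$ connecting $k$ and $l$. Then $$\mathrm{SCI}_{G,H}=\mathrm{CI}_{G,H}=\mathcal I(\mathcal M_1(G,H))=\langle \sigma_{ij},\ \sigma_p \;:\; ij\notin E_H,\ p\text{ a path in }H\text{ such that }e(p)\notin E_G\rangle .$$
   Context: $E_G$ denotes the edge set of $G$, and $E_G^{\mathsf c}$ the set of non-edges (unordered pairs of distinct vertices not in $E_G$). $\mathrm{PD}_n$ is the set of real symmetric positive definite $n\times n$ matrices. $\mathcal M_1(G,H)$ is the set of $\Sigma\in\mathrm{PD}_n$ with all diagonal entries equal to $1$, $(\Sigma^{-1})_{ij}=0$ for all $ij\in E_G^{\mathsf c}$, and $\Sigma_{kl}=0$ for all $kl\in E_H^{\mathsf c}$; $\mathcal I(\mathcal M_1(G,H))\subseteq\mathbb R[\sigma_{ij}:i<j]$ is its vanishing ideal. Let $\Sigma=(\sigma_{ij})$ be the generic symmetric $n\times n$ matrix with ones on the diagonal and entries in $\mathbb R[\sigma_{ij}:i<j]$. For index sets $I,J$, $\Sigma_{I,J}$ is the submatrix with rows $I$ and columns $J$; $kC=\{k\}\cup C$. The ideal $\mathrm{CI}_{G,H}\subseteq\mathbb R[\sigma_{ij}:i<j]$ is the saturation of $$\langle \sigma_{ij},\ \det(\Sigma_{kC,lC}) : ij\in E_H^{\mathsf c},\ kl\in E_G^{\mathsf c},\ C\subseteq N\setminus\{k,l\}\text{ separates } k \text{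 and } l\text{ in }G\rangle$$ at the product of all principal minors of $\Sigma$. The ideal $\mathrm{SCI}_{G,H}\subseteq\mathbb R[\sigma_{ij}:i<j]$ is the saturation of $$\langle \sigma_{ij},\ \det(\Sigma_{N\setminus l,N\setminus k}) : ij\in E_H^{\mathsf c},\ kl\in E_G^{\mathsf c}\rangle$$ at the product of all principal minors of $\Sigma$. A path $p$ traverses no vertex more than once and has two distinct endpoints; $e(p)=kl$ is its pair of endpoints and $\sigma_p=\prod_{ij\in p}\sigma_{ij}$ is the product of the variables of the edges of $p$. *)

(* Defs.v *)
From mathcomp Require Import all_boot all_order all_algebra.
From mathcomp Require Import classical_sets reals.
From mathcomp Require Import mpoly.

Set Implicit Arguments.
Unset Strict Implicit.
Unset Printing Implicit Defensive.

Import Order.TTheory GRing.Theory Num.Theory.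

Local Open Scope ring_scope.

(* The type [set T] of classical_sets is [T -> Prop]; it is used for ideals and
   models, while [{set 'I_n}] (finset) is used for sets of vertices. *)

Record sgraph (n : nat) := SGraph {
  adj :> rel 'I_n;
  adj_sym : ssrbool.symmetric adj;
  adj_irr : irreflexive adj
}.

Definition nonedge (n : nat) (G : sgraph n) (i j : 'I_n) : bool :=
  (i != j) && ~~ G i j.

(* The path with vertex sequence [k :: p]. As k != l, an undirected path with
   endpoints k and l is listed exactly once as a sequence from k to l. *)
Definition is_path (n : nat) (G : sgraph n) (k l : 'I_n) (p : seq 'I_n) : bool :=
  [&& k != l, path G k p, last k p == l & uniq (k :: p)].

Definition separates (n : nat) (G : sgraph n) (C : {set 'I_n}) (k l : 'I_n) :
    Prop :=
  forall p : seq 'I_n, is_path G k l p ->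
    exists2 v : 'I_n, v \in k :: p & v \in C.

(* The variables sigma_{ij} of the polynomial ring are indexed by the pairs
   i < j, numbered through [enum_rank]. *)
Definition upair (n : nat) : predArgType :=
  {e : 'I_n * 'I_n | (e.1 < e.2)%N}.

Definition nvars (n : nat) : nat := #|{: upair n}|.

Notation cpoly R n := {mpoly R[nvars n]}.

(* Symmetric in i and j, and equal to 1 if i = j; in the first two cases
   [insub] never fails. *)
Definition sigma (R : realType) (n : nat) (i j : 'I_n) : cpoly R n :=
  let var (e : 'I_n * 'I_n) : cpoly R n :=
    if insub e is Some u then 'X_(enum_rank (u : upair n)) else 0 in
  if (i < j)%N then var (i, j) else if (j < i)%N then var (j, i) else 1.

Definition Sigma (R : realType) (n : nat) : 'M[cpoly R n]_n :=
  \matrix_(i, j) sigma R i j.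

(* det (A_{I,J}), rows and columns listed in increasing order. Only meaningful
   for #|I| = #|J|, in which case [conform_mx _ B] is B with its type cast. *)
Definition minor (A : comNzRingType) (n : nat) (M : 'M[A]_n)
    (I J : {set 'I_n}) : A :=
  \det (conform_mx (0 : 'M[A]_#|I|)
          (mxsub (@enum_val _ (mem I)) (@enum_val _ (mem J)) M)).

Definition principal_minors_prod (R : realType) (n : nat) : cpoly R n :=
  \prod_(I : {set 'I_n}) minor (Sigma R n) I I.

Definition ideal_gen (A : comNzRingType) (S : set A) : set A :=
  fun f => exists (m : nat) (c g : 'I_m -> A),
    (forall i, S (g i)) /\ f = \sum_(i < m) c i * g i.

Definition saturation (A : comNzRingType) (I : set A) (h : A) : set A :=
  fun f => exists m : nat, I (h ^+ m * f).

Definition CI (R : realType) (n : nat) (G H : sgraph n) : set (cpoly R n) :=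
  saturation
    (ideal_gen (fun f =>
       (exists i j : 'I_n, nonedge H i j /\ f = sigma R i j) \/
       (exists (k l : 'I_n) (C : {set 'I_n}),
          [/\ nonedge G k l, C \subset ~: [set k; l], separates G C k l
            & f = minor (Sigma R n) (k |: C) (l |: C)])))
    (principal_minors_prod R n).

Definition SCI (R : realType) (n : nat) (G H : sgraph n) : set (cpoly R n) :=
  saturation
    (ideal_gen (fun f =>
       (exists i j : 'I_n, nonedge H i j /\ f = sigma R i j) \/
       (exists k l : 'I_n,
          nonedge G k l /\ f = minor (Sigma R n) [set~ l] [set~ k])))
    (principal_minors_prod R n).

Definition posdefmx (R : realType) (n : nat) (S : 'M[R]_n) : Prop :=
  S^T = S /\ forall x : 'cV[R]_n, x != 0 -> 0 < (x^T *m S *m x) ord0 ord0.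

Definition model1 (R : realType) (n : nat) (G H : sgraph n) : set 'M[R]_n :=
  fun S => [/\ posdefmx S,
    forall i, S i i = 1,
    forall i j, nonedge G i j -> (invmx S) i j = 0
    & forall k l, nonedge H k l -> S k l = 0].

Definition eval_at (R : realType) (n : nat) (f : cpoly R n) (S : 'M[R]_n) : R :=
  f.@[fun v => let e := val (enum_val v : upair n) in S e.1 e.2].

Definition vanishing_ideal (R : realType) (n : nat) (M : set 'M[R]_n) :
    set (cpoly R n) :=
  fun f => forall S : 'M[R]_n, M S -> eval_at f S = 0.

Definition path_monomial (R : realType) (n : nat) (k : 'I_n) (p : seq 'I_n) :
    cpoly R n :=
  \prod_(e <- zip (k :: p) p) sigma R e.1 e.2.

Definition path_ideal (R : realType) (n : nat) (G H : sgraph n) :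
    set (cpoly R n) :=
  ideal_gen (fun f =>
    (exists i j : 'I_n, nonedge H i j /\ f = sigma R i j) \/
    (exists (k l : 'I_n) (p : seq 'I_n),
       [/\ is_path H k l p, nonedge G k l & f = path_monomial R k p])).

Arguments CI R {n} G H _.
Arguments SCI R {n} G H _.
Arguments model1 R {n} G H _.
Arguments path_ideal R {n} G H _.

(* Main.v *)
Require Import Defs.
From mathcomp Require Import all_boot all_order all_fingroup all_algebra.
From mathcomp Require Import boolp classical_sets reals.
From mathcomp Require Import mpoly.

(* Expanding det (Sigma_{kC,lC}) along row k, then along the row of the chosen
   column, and so on, writes it as a signed sum over the paths from k to l
   inside C of the path monomial times the principal minor of the vertices of C
   that the path misses.  Modulo the non-edges of H only paths of H matter, so
   these determinants lie in the path ideal P; when the path is unique, its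
   monomial is the determinant up to a principal minor, hence P <= SCI.  As
   principal minors do not vanish on positive definite matrices,
   P <= SCI <= CI <= I(M_1).  Conversely, P is a squarefree monomial ideal, and
   near the identity matrix its real zeros are positive definite, hence in M_1.
   If a monomial of f is not in P, then M_1 contains a neighbourhood of 0 in the
   coordinate subspace of its variables, on which f does not vanish identically;
   hence I(M_1) <= P. *)

Set Implicit Arguments.
Unset Strict Implicit.
Unset Printing Implicit Defensive.

(* classical_sets shadows the notations and lemmas on finite sets. *)
Import mathcomp.boot.finset.
Import Order.TTheory GRing.Theory Num.Theory.

Local Open Scope ring_scope.

(** * Ideals, generated ideals and saturations *)

Definition is_ideal (A : comNzRingType) (I : set A) : Prop :=
  [/\ I 0, forall x y, I x -> I y -> I (x + y) & forall a x, I x -> I (a * x)].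

Section Ideals.
Variable A : comNzRingType.
Implicit Types (I S : set A) (x h : A).

Lemma ideal_sum I (T : finType) (P : pred T) (F : T -> A) :
  is_ideal I -> (forall i, P i -> I (F i)) -> I (\sum_(i | P i) F i).
Proof. by move=> [I0 ID _] IF; elim/big_ind: _. Qed.

Lemma ideal_signK I (b : bool) x : is_ideal I -> I ((-1) ^+ b * x) -> I x.
Proof. by move=> [_ _ IM] /(IM ((-1) ^+ b)); rewrite signrMK. Qed.

Lemma ideal_addK I x y : is_ideal I -> I y -> I (x + y) -> I x.
Proof.
move=> [_ ID IM] Iy Ixy; rewrite -[x](addrK y) -mulN1r.
by apply: ID => //; apply: IM.
Qed.

Lemma is_ideal_gen S : is_ideal (ideal_gen S).
Proof.
split.
- by exists 0%N, (fun _ => 0), (fun _ => 0); split=> [[]//|]; rewrite big_ord0.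
- move=> x y [m1 [c1 [g1 [S1 ->]]]] [m2 [c2 [g2 [S2 ->]]]].
  exists (m1 + m2)%N.
  exists (fun i => match split i with inl j => c1 j | inr j => c2 j end).
  exists (fun i => match split i with inl j => g1 j | inr j => g2 j end).
  split=> [i|]; first by case: (split i).
  rewrite big_split_ord /=; congr (_ + _); apply: eq_bigr => i _.
    by case: split_ordP => j; [move/lshift_inj-> | move/eqP; rewrite eq_lrshift].
  by case: split_ordP => j; [move/eqP; rewrite eq_rlshift | move/rshift_inj->].
- move=> a x [m [c [g [Sg ->]]]]; exists m, (fun i => a * c i), g; split=> //.
  by rewrite big_distrr /=; apply: eq_bigr => i _; rewrite mulrA.
Qed.

Lemma mem_ideal_gen S x : S x -> ideal_gen S x.
Proof.
move=> Sx; exists 1%N, (fun _ => 1), (fun _ => x); split=> //.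
by rewrite big_ord1 mul1r.
Qed.

Lemma ideal_gen_min S I :
  is_ideal I -> (forall x, S x -> I x) -> forall x, ideal_gen S x -> I x.
Proof.
move=> idI SI _ [m [c [g [Sg ->]]]]; apply: ideal_sum => // i _.
by case: idI => _ _ IM; apply/IM/SI.
Qed.

Lemma is_ideal_saturation I h : is_ideal I -> is_ideal (saturation I h).
Proof.
move=> [I0 ID IM]; split.
- by exists 0%N; rewrite mulr0.
- move=> x y [m1 I1] [m2 I2]; exists (m1 + m2)%N; rewrite mulrDr.
  apply: ID; last by rewrite exprD -mulrA; apply: IM.
  by rewrite exprD mulrAC mulrC; apply: IM.
- by move=> a x [m Im]; exists m; rewrite mulrCA; apply: IM.
Qed.

Lemma mem_saturation I h x : I x -> saturation I h x.
Proof. by move=> Ix; exists 0%N; rewrite mul1r. Qed.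

(** One more power of [h] supplies the factor [d]. With [h] the product of all principal minors, any
    single one can be cancelled. *)
Lemma saturation_dvdK I h c d x : is_ideal I -> h = c * d ->
  saturation I h (x * d) -> saturation I h x.
Proof.
move=> [_ _ IM] Dh [m Im]; exists m.+1.
rewrite exprSr {2}Dh (_ : _ * x = c * (h ^+ m * (x * d))); first exact: IM.
by rewrite -!mulrA (mulrC x) mulrCA.
Qed.

End Ideals.

(** * Minors up to sign and Laplace expansion *)

Section Minors.
Variable A : comNzRingType.

Lemma eq_codom_perm (m n : nat) (f g : 'I_m -> 'I_n) :
  injective f -> f @: [set: 'I_m] = g @: [set: 'I_m] ->
  exists s : 'S_m, forall i, f i = g (s i).
Proof.
move=> f_inj fg.
have [|h fh] := @fin_all_exists _ _ (fun i j => f i = g j).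
  move=> i; have: f i \in g @: [set: 'I_m] by rewrite -fg imset_f.
  by case/imsetP=> j _ ->; exists j.
have h_inj : injective h by move=> i j hij; apply: f_inj; rewrite !fh hij.
by exists (perm h_inj) => i; rewrite permE.
Qed.

Lemma det_mxsub_perm (m n : nat) (M : 'M[A]_n) (f g : 'I_m -> 'I_n)
    (s t : 'S_m) :
  exists b : bool,
    \det (mxsub (f \o s) (g \o t) M) = (-1) ^+ b * \det (mxsub f g M).
Proof.
exists (s (+) t); rewrite mxsub_comp mxsubrc -row_permEsub -col_permEsub.
rewrite row_permE col_permE !det_mulmx !det_perm odd_permV signr_addb.
by rewrite (mulrC (\det _)) mulrA.
Qed.

(** Two enumerations of a set differ by a permutation. The sign stays existential, since membership
    in an ideal does not see it. *)
Lemma minor_mxsub (m n : nat) (M : 'M[A]_n) (f g : 'I_m -> 'I_n)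
    (I J : {set 'I_n}) :
  injective f -> injective g -> f @: [set: 'I_m] = I -> g @: [set: 'I_m] = J ->
  exists b : bool, minor M I J = (-1) ^+ b * \det (mxsub f g M).
Proof.
move=> f_inj g_inj fI gJ.
have cI : #|I| = m by rewrite -fI card_imset // cardsT card_ord.
have cJ : #|J| = #|I| by rewrite cI -gJ card_imset // cardsT card_ord.
subst m; rewrite /minor.
(* The sizes agree, so the default 0 of [conform_mx] disappears and the cast moves into the
   enumeration of the columns. *)
rewrite -(conform_castmx (erefl, cJ)) conform_mx_id castmxEsub -mxsub_comp /=.
have [|s fs] := eq_codom_perm (g := f) (@enum_val_inj _ (mem I)).
  rewrite fI; apply/setP=> x; apply/imsetP/idP=> [[i _ ->]|xI].
    exact: enum_valP.
  by exists (enum_rank_in xI x) => //; rewrite enum_rankK_in.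
have [|t gt] := eq_codom_perm (g := g)
    (f := fun i => enum_val (cast_ord (esym cJ) i))
    (inj_comp (@enum_val_inj _ (mem J)) (@cast_ord_inj _ _ _)).
  rewrite gJ; apply/setP=> x; apply/imsetP/idP=> [[i _ ->]|xJ].
    exact: enum_valP.
  by exists (cast_ord cJ (enum_rank_in xJ x)); rewrite // cast_ordK enum_rankK_in.
rewrite (@eq_mxsub _ _ _ _ _ _ (f \o s) _ (g \o t)); first exact: det_mxsub_perm.
  by move=> i /=; rewrite -fs cast_ord_id.
by move=> i /=; rewrite -gt.
Qed.

Lemma set_ord_enum (n m : nat) (I : {set 'I_n}) : #|I| = m ->
  exists2 f : 'I_m -> 'I_n, injective f & f @: [set: 'I_m] = I.
Proof.
move=> <-; exists (@enum_val _ (mem I)); first exact: enum_val_inj.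
apply/setP=> x; apply/imsetP/idP=> [[i _ ->]|xI]; first exact: enum_valP.
by exists (enum_rank_in xI x) => //; rewrite enum_rankK_in.
Qed.

Lemma imset_lift (n m : nat) (f : 'I_m.+1 -> 'I_n) (i0 : 'I_m.+1) :
  injective f ->
  (f \o lift i0) @: [set: 'I_m] = f @: [set: 'I_m.+1] :\ f i0.
Proof.
move=> f_inj; apply/setP=> x; rewrite !inE; apply/imsetP/andP=> [[i _ ->]|] /=.
  by rewrite imset_f // (inj_eq f_inj) eq_sym neq_lift.
case=> + /imsetP[j _ Dx]; rewrite Dx (inj_eq f_inj) eq_sym => /unlift_some[i Di _].
by exists i; rewrite ?inE /= -?Di.
Qed.

(** Laplace expansion along row [k]. The remaining row set is [C], so if [j] is in [C] one can
    expand again along row [j]. *)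
Lemma minor_expand (n : nat) (M : 'M[A]_n) (k : 'I_n) (C J : {set 'I_n}) :
  k \notin C -> #|J| = #|C|.+1 ->
  exists s : 'I_n -> bool, minor M (k |: C) J =
    \sum_(j in J) (-1) ^+ s j * (M k j * minor M C (J :\ j)).
Proof.
move=> kC cJ; have cI : #|k |: C| = #|C|.+1 by rewrite cardsU1 kC.
have [f f_inj fI] := set_ord_enum cI; have [g g_inj gJ] := set_ord_enum cJ.
have [b ->] := minor_mxsub M f_inj g_inj fI gJ.
have /imsetP[i0 _ Dk] : k \in f @: setT by rewrite fI setU11.
(* The sign is chosen per column label [j]; outside [J] no [i] satisfies [g i = j], and any sign
   does. *)
have [|s Ds] := @fin_all_exists _ _ (fun j (sj : bool) => forall i, g i = j ->
    (-1) ^+ b * (mxsub f g M i0 i * cofactor (mxsub f g M) i0 i) =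
    (-1) ^+ sj * (M k j * minor M C (J :\ j))).
  move=> j; have [jJ|jJ] := boolP (j \in J); last first.
    by exists false => i gi; case/negP: jJ; rewrite -gJ -gi imset_f.
  have /imsetP[i _ Dj] : j \in g @: [set: _] by rewrite gJ.
  have fC : (f \o lift i0) @: setT = C.
    by rewrite imset_lift // fI -Dk setU1K.
  have gC : (g \o lift i) @: setT = J :\ j by rewrite imset_lift // gJ -Dj.
  have [c Dc] := minor_mxsub M (inj_comp f_inj (@lift_inj _ i0))
    (inj_comp g_inj (@lift_inj _ i)) fC gC.
  exists (b (+) odd (i0 + i) (+) c) => i'; rewrite {1}Dj => /g_inj->.
  rewrite Dc mxE -Dk -Dj /cofactor !signr_addb -(signr_odd _ (i0 + i)).
  rewrite (_ : row' _ _ = mxsub (f \o lift i0) (g \o lift i) M).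
    by rewrite -!mulrA !(mulrCA (M k j)) signrMK.
  by apply/matrixP=> x y; rewrite !mxE.
exists s; rewrite (expand_det_row _ i0) big_distrr /= -gJ big_imset /=.
  by rewrite gJ; apply: eq_big => [i|i _]; [rewrite inE | apply: Ds].
by move=> ? ? _ _; apply: g_inj.
Qed.

End Minors.

(** * Path expansion of determinants modulo an ideal *)

Section PathExpansion.
Variables (A : comNzRingType) (n : nat) (H : sgraph n) (M : 'M[A]_n) (I : set A).
Hypothesis idI : is_ideal I.
Hypothesis nonedgeI : forall i j, nonedge H i j -> I (M i j).
Implicit Types (k l c : 'I_n) (C : {set 'I_n}) (p q : seq 'I_n) (a : A).

(** This is [path_monomial] for a matrix over any ring: the expansion serves the generic matrix and
    also its real specialisations, with [I] the zero ideal. *)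
Definition path_weight k p : A := \prod_(e <- zip (k :: p) p) M e.1 e.2.

Lemma path_weight_cons k c p : path_weight k (c :: p) = M k c * path_weight c p.
Proof. by rewrite /path_weight /= big_cons. Qed.

Lemma path_weight_nil k : path_weight k [::] = 1.
Proof. by rewrite /path_weight /= big_nil. Qed.

Lemma is_path_edge k l : k != l -> H k l -> is_path H k l [:: l].
Proof. by move=> kl Hkl; rewrite /is_path kl /= Hkl eqxx inE kl. Qed.

Lemma is_path_cons k l c p : k != l -> H k c -> k \notin c :: p ->
  is_path H c l p -> is_path H k l (c :: p).
Proof.
move=> kl Hkc kp /and4P[cl Hp lp up].
by rewrite /is_path kl /= Hkc Hp lp kp.
Qed.

Lemma entry_ideal_or_edge i j : i != j -> I (M i j) \/ H i j.
Proof.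
by move=> ij; case: (boolP (H i j)) => [|nH]; [right | left; apply/nonedgeI/andP].
Qed.

Lemma sub_setU1D1 k l c C p : c \in C -> k \notin l |: C ->
  {subset p <= l |: C :\ c} ->
  {subset c :: p <= l |: C} /\ k \notin c :: p.
Proof.
move=> cC klC sp; have sub : {subset c :: p <= l |: C}.
  move=> x /[!inE] /orP[/eqP->|/sp]; first by rewrite cC orbT.
  by rewrite !inE => /orP[->//|/andP[_ ->]]; rewrite orbT.
by split=> //; apply: contra klC; apply: sub.
Qed.

Lemma setU1D1C l j C : j != l -> (l |: C) :\ j = l |: (C :\ j).
Proof.
move=> jl; apply/setP=> x; rewrite !inE; have [->|] //= := eqVneq x j.
by rewrite orbF (negPf jl).
Qed.

(* In the induction [a] is the weight of the part of the path already walked. *)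
Lemma minor_in_path_ideal k l C a : k != l -> k \notin C -> l \notin C ->
  (forall p, is_path H k l p -> {subset p <= l |: C} -> I (a * path_weight k p)) ->
  I (a * minor M (k |: C) (l |: C)).
Proof.
have [m] := ubnP #|C|; elim: m => // m IH in k C a *.
move=> /ltnSE Cm kl kC lC pathI.
have klC : k \notin l |: C by rewrite !inE negb_or kl.
have cJ : #|l |: C| = #|C|.+1 by rewrite cardsU1 lC.
have [s ->] := minor_expand M kC cJ; have [_ _ IM] := idI.
rewrite big_distrr; apply: ideal_sum => //= j jC.
rewrite mulrCA; apply: (IM); rewrite mulrA.
have kj : k != j by apply: contraNneq klC => ->.
have [IMkj|Hkj] := entry_ideal_or_edge kj.
  by rewrite mulrC; do 2!apply: (IM).
have [jl|jl] := eqVneq j l.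
  rewrite mulrC; apply: (IM); rewrite jl -[M k l]mulr1 -(path_weight_nil l).
  rewrite -path_weight_cons; apply: pathI; first by rewrite is_path_edge // -jl.
  by move=> x; rewrite !inE => ->.
have {}jC : j \in C by move: jC; rewrite !inE (negPf jl).
(* The vertex [j] takes the place of [k]: the rows become [j |: (C :\ j)] and the columns
   [l |: (C :\ j)]. *)
have {1}<- : j |: (C :\ j) = C by rewrite setD1K.
rewrite setU1D1C //.
apply: IH => //; [|by rewrite !inE eqxx|by rewrite !inE (negPf lC) andbF|].
  by apply: leq_trans Cm; rewrite [in leqRHS](cardsD1 j) jC.
move=> p Hp sp; have [sjp kjp] := sub_setU1D1 jC klC sp.
rewrite -mulrA -path_weight_cons; apply: pathI => //.
exact: is_path_cons.
Qed.

(** Induction along [q]: in the expansion along row [k], only the column of the next vertex of [q]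
    survives modulo [I]. Once [l] is reached, the remaining minor is principal and the first
    hypothesis cancels it. *)
Lemma path_weight_in_ideal k l C a q :
  (forall (D : {set 'I_n}) x, I (x * minor M D D) -> I x) ->
  k \notin C -> l \notin C -> is_path H k l q -> {subset q <= l |: C} ->
  (forall p, is_path H k l p -> {subset p <= l |: C} -> p = q) ->
  I (a * minor M (k |: C) (l |: C)) -> I (a * path_weight k q).
Proof.
move=> minorK; elim: q => [|c q IH] in k C a *.
  by move=> _ _ /and4P[/negPf kl _ /=]; rewrite kl.
move=> kC lC pq sq uq; have [_ _ IM] := idI.
have /and4P[kl /=/andP[Hkc Hq] lq /andP[kq uqq]] := pq.
have klC : k \notin l |: C by rewrite !inE negb_or kl.
have cJ : #|l |: C| = #|C|.+1 by rewrite cardsU1 lC.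
have clC : c \in l |: C by apply: sq; rewrite mem_head.
have [s ->] := minor_expand M kC cJ.
rewrite (bigD1 c) //= mulrDr => Isum.
have: I (a * ((-1) ^+ s c * (M k c * minor M C ((l |: C) :\ c)))).
  apply: ideal_addK idI _ Isum.
  rewrite big_distrr; apply: ideal_sum => //= j /andP[jlC jc].
  rewrite mulrCA; apply: (IM); apply: (IM).
  have kj : k != j by apply: contraNneq klC => ->.
  have [IMkj|Hkj] := entry_ideal_or_edge kj; first by rewrite mulrC; apply: IM.
  have [jl|jl] := eqVneq j l.
    have [lc _] : [:: l] = c :: q.
      apply: uq; first by rewrite is_path_edge // -jl.
      by move=> x; rewrite !inE => ->.
    by rewrite jl lc eqxx in jc.
  have {jlC} jC : j \in C by move: jlC; rewrite !inE (negPf jl).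
  have {1}<- : j |: (C :\ j) = C by rewrite setD1K.
  (* The path hypothesis holds vacuously: a path from [j] to [l], prefixed by [k], would be a second
     path besides [c :: q]. *)
  rewrite setU1D1C //; apply: minor_in_path_ideal => //.
  - by rewrite !inE eqxx.
  - by rewrite !inE (negPf lC) andbF.
  move=> p Hp sp; have [sjp kjp] := sub_setU1D1 jC klC sp.
  have [jc' _] := uq _ (is_path_cons kl Hkj kjp Hp) sjp.
  by rewrite jc' eqxx in jc.
rewrite mulrCA => /(ideal_signK idI); rewrite mulrA path_weight_cons mulrA.
have [cl|cl] := eqVneq c l.
  rewrite cl setU1K // => /minorK IMkl.
  by rewrite mulrC; apply: IM.
have cC : c \in C by move: clC; rewrite !inE (negPf cl).
have Hcq : is_path H c l q by rewrite /is_path cl Hq lq /= uqq.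
have {1}<- : c |: (C :\ c) = C by rewrite setD1K.
rewrite setU1D1C //; apply: IH => //.
- by rewrite !inE eqxx.
- by rewrite !inE (negPf lC) andbF.
- move=> x xq; have := sq x; rewrite !inE xq orbT => /(_ isT)/orP[->//|->].
  rewrite andbT; have [xc|] := eqVneq x c; last by rewrite orbT.
  by case/andP: uqq; rewrite -xc xq.
move=> p Hp sp; have [sjp kjp] := sub_setU1D1 cC klC sp.
by have [] := uq _ (is_path_cons kl Hkc kjp Hp) sjp.
Qed.

End PathExpansion.

(** * Points near the origin where a polynomial does not vanish *)

Lemma digits_inj (N B : nat) (a b : 'I_N -> nat) :
  (forall v, a v < B)%N -> (forall v, b v < B)%N ->
  (\sum_v a v * B ^ v = \sum_v b v * B ^ v)%N -> a =1 b.
Proof.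
elim: N a b => [|N IH] a b aB bB; first by move=> _ [].
have shift (c : 'I_N.+1 -> nat) : (\sum_v c v * B ^ v =
    (\sum_(v < N) c (lift ord0 v) * B ^ v) * B + c ord0)%N.
  rewrite big_ord_recl expn0 muln1 addnC big_distrl /=; congr (_ + _)%N.
  by apply: eq_bigr => v _; rewrite /bump /= add1n expnSr mulnA.
rewrite !shift => Eab.
have Eab0 : a ord0 = b ord0.
  by have := congr1 (modn^~ B) Eab; rewrite /= !modnMDl !modn_small.
have B0 : (0 < B)%N by apply: leq_ltn_trans (aB ord0).
move: Eab; rewrite Eab0 => /addIn/eqP; rewrite eqn_pmul2r // => /eqP Eab v.
case: (unliftP ord0 v) => [u ->|-> //].
by apply: (IH (a \o lift ord0) (b \o lift ord0)) => // ? /=.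
Qed.

(* Kronecker substitution: on the curve sending the variables of m to distinct
   powers of t, and the others to 0, f restricts to a polynomial in t in which
   the coefficient of m survives. *)
Lemma mpoly_nonzero_near0 (R : realFieldType) (N : nat) (f : {mpoly R[N]})
    (m : 'X_{1..N}) (e : R) : 0 < e -> m \in msupp f ->
  exists x : 'I_N -> R, [/\ forall v, 0 <= x v < e,
    forall v, x v != 0 -> m v != 0%N & f.@[x] != 0].
Proof.
(* [msize f] exceeds the degree of every monomial of [f], so all exponents are digits in base
   [B]. *)
move=> e0 mf; pose B := msize f.
have ltB m' (v : 'I_N) : m' \in msupp f -> (m' v < B)%N.
  move/msize_mdeg_lt; apply: leq_ltn_trans.
  by rewrite mdegE (bigD1 v) //= leq_addr.
pose w (m' : 'X_{1..N}) := (\sum_(v < N) B ^ v.+1 * m' v)%N.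
pose X (v : 'I_N) : {poly R} := if m v == 0%N then 0 else 'X^(B ^ v.+1).
pose Q := \sum_(m' <- msupp f) f@_m' *: \prod_v X v ^+ m' v.
have w_inj m' : m' \in msupp f -> w m' = w m -> m' = m.
  move=> m'f Ew; apply/mnmP; apply: (@digits_inj _ B) => [v|v|]; try exact: ltB.
  have wB (m1 : 'X_{1..N}) : w m1 = ((\sum_(v < N) m1 v * B ^ v) * B)%N.
    rewrite big_distrl; apply: eq_bigr => v _ /=.
    by rewrite expnSr mulnC mulnA.
  have B0 : (0 < B)%N by apply: leq_trans (msize_mdeg_lt mf).
  by apply/eqP; rewrite -(eqn_pmul2r B0) -!wB Ew.
have Xprod (m' : 'X_{1..N}) : (forall v, m v = 0%N -> m' v = 0%N) ->
    \prod_v X v ^+ m' v = 'X^(w m').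
  move=> m'm; rewrite /w -prodrXr; apply: eq_bigr => v _.
  by rewrite /X; case: eqP => [/m'm->|_]; rewrite ?muln0 ?expr0 ?exprM.
(* Any other monomial of [f] either has a variable outside [m] and is sent to 0, or yields a power
   of t other than [w m], by [w_inj]. *)
have Qm : Q`_(w m) = f@_m.
  rewrite coef_sum (bigD1_seq m) ?msupp_uniq //= coefZ Xprod // coefXn eqxx mulr1.
  rewrite big_seq_cond big1 ?addr0 // => m' /andP[m'f m'm]; rewrite coefZ.
  case: (boolP [forall v, (m v == 0%N) ==> (m' v == 0%N)]) => [/forallP mm'|].
    rewrite Xprod => [|v /eqP mv]; last by apply/eqP; apply: implyP (mm' v) mv.
    rewrite coefXn; case: eqP => [/esym/(w_inj _ m'f) Em'|]; last by rewrite mulr0.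
    by rewrite Em' eqxx in m'm.
  case/forallPn=> v; rewrite negb_imply => /andP[mv m'v].
  by rewrite (bigD1 v) //= /X mv expr0n (negPf m'v) mul0r coef0 mulr0.
have Q0 : Q != 0.
  by apply: contraTneq mf => Q0; rewrite mcoeff_msupp negbK -Qm Q0 coef0.
(* Below 1, every positive power of t is at most t, hence also below [e]. *)
pose e1 := Num.min e 1 / 2.
have me : 0 < Num.min e 1 by rewrite lt_min e0 ltr01.
have e1_gt0 : 0 < e1 by rewrite divr_gt0.
have e1_lt : e1 < Num.min e 1 by rewrite ltr_pdivrMr // mulr_natr mulr2n ltrDl.
(* These are [size Q] distinct candidates for t, more than [Q] has roots. *)
pose ts := [seq e1 / i.+1%:R | i <- iota 0 (size Q)].
have ts_uniq : uniq ts.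
  rewrite map_inj_uniq ?iota_uniq // => i j /(mulfI (lt0r_neq0 e1_gt0))/invr_inj.
  by move/eqP; rewrite eqr_nat eqSS => /eqP.
have : ~~ all (root Q) ts.
  apply/negP => /(max_poly_roots Q0)/(_ ts_uniq).
  by rewrite size_map size_iota ltnn.
case/allPn=> t /mapP[i _ Dt] Qt.
have t0 : 0 < t by rewrite Dt divr_gt0.
have te : t <= e1 by rewrite Dt ler_pdivrMr // -[leLHS]mulr1 ler_pM2l // ler1n.
have t1 : t < 1.
  by apply: le_lt_trans te (lt_le_trans e1_lt _); rewrite ge_min lexx orbT.
exists (fun v => (X v).[t]); split=> [v|v|].
- rewrite /X; case: eqP => _; rewrite ?horner0 ?lexx // hornerXn.
  rewrite exprn_ge0 ?ltW //=; apply: le_lt_trans (le_trans _ te) (lt_le_trans e1_lt _).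
    rewrite -[leRHS]expr1; apply: ler_wiXn2l; rewrite ?ltW // expn_gt0.
    by rewrite (leq_trans _ (msize_mdeg_lt mf)).
  by rewrite ge_min lexx.
- by apply: contraNneq => mv; rewrite /X mv horner0.
- suff -> : f.@[fun v => (X v).[t]] = Q.[t] by [].
  rewrite mevalE horner_sum; apply: eq_bigr => m' _.
  rewrite hornerZ horner_prod; congr (_ * _).
  by apply: eq_bigr => v _; rewrite horner_exp.
Qed.

(** * Positive definite matrices, their minors and inverses *)

(** Bounding |x_i x_j| by (x_i^2 + x_j^2) / 2 gives x^T S x >= (1 - e n) sum_i x_i^2. *)
Lemma posdefmx_near1 (R : realType) (n : nat) (S : 'M[R]_n) (e : R) :
  S^T = S -> (forall i, S i i = 1) -> 0 <= e -> e * n%:R < 1 ->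
  (forall i j, i != j -> `|S i j| <= e) -> posdefmx S.
Proof.
move=> symS diagS e0 en S_le; split=> // x x0.
have sqx : 0 < \sum_i x i ord0 ^+ 2.
  rewrite lt_neqAle sumr_ge0 => [|i _]; last exact: sqr_ge0.
  rewrite andbT eq_sym; apply: contra x0 => /eqP/psumr_eq0P x0.
  apply/eqP/matrixP => i j; rewrite mxE ord1; apply/eqP.
  by rewrite -sqrf_eq0; apply/eqP/x0 => // k _; apply: sqr_ge0.
pose q i := x i ord0 ^+ 2.
have q0 i : 0 <= q i by apply: sqr_ge0.
have term i j : (if i == j then q i else 0) - e * ((q i + q j) / 2)
    <= x i ord0 * S i j * x j ord0.
  case: eqVneq => [->|ij].
    rewrite diagS mulr1 -expr2 lerBlDr lerDl mulr_ge0 ?divr_ge0 ?addr_ge0 //.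
  rewrite sub0r mulrAC lerNl -mulrN (le_trans (ler_norm _)) // normrM normrN mulrC.
  apply: ler_pM => //; first exact: S_le.
  rewrite ler_pdivlMr // normrM mulr_natr /q -(real_normK (num_real (x i ord0))).
  rewrite -(real_normK (num_real (x j ord0))) -subr_ge0.
  rewrite (_ : _ - _ = (`|x i ord0| - `|x j ord0|) ^+ 2) ?sqr_ge0 //.
  by rewrite sqrrB addrAC.
apply: lt_le_trans (_ : (1 - e * n%:R) * \sum_i q i <= _).
  by rewrite mulr_gt0 ?subr_gt0.
rewrite mxE; under [leRHS]eq_bigr do rewrite mxE big_distrl /=.
rewrite exchange_big /=.
apply: le_trans (_ : \sum_i \sum_j
   ((if i == j then q i else 0) - e * ((q i + q j) / 2)) <= _); last first.
  by apply: ler_sum => i _; apply: ler_sum => j _; rewrite mxE term.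
under [leRHS]eq_bigr => i _.
  rewrite big_split /= -big_mkcond (big_pred1 i) => [|j]; last by rewrite eq_sym.
  rewrite sumrN -big_distrr -big_distrl big_split /= sumr_const card_ord.
  over.
rewrite big_split /= sumrN -big_distrr -big_distrl /= big_split /= sumr_const.
rewrite card_ord sumrMnl mulrBl mul1r mulrDl -splitr.
by rewrite -[(\sum_i _) *+ _]mulr_natl mulrA.
Qed.

(** A kernel vector of the principal submatrix, extended by zeros through [P], would be a nonzero
    vector on which the quadratic form of [S] vanishes. *)
Lemma posdefmx_minor_neq0 (R : realType) (n : nat) (S : 'M[R]_n) (I : {set 'I_n}) :
  posdefmx S -> minor S I I != 0.
Proof.
move=> [_ posS]; have [f f_inj fI] := set_ord_enum (erefl #|I|).
have [b ->] := minor_mxsub S f_inj f_inj fI fI; rewrite mulf_eq0 signr_eq0 /=.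
apply/det0P => -[v v0 vS]; pose P : 'M[R]_(#|I|, n) := rowsub f 1%:M.
have PSP : mxsub f f S = P *m S *m P^T.
  rewrite mul_rowsub_mx mul1mx -[P^T]/((rowsub f 1%:M)^T) trmx_mxsub.
  by rewrite trmx1 mulmx_colsub mulmx1 -mxsubcr.
have vP0 : (v *m P)^T != 0.
  apply: contra v0 => /eqP/(congr1 trmx); rewrite trmxK trmx0 => vP0.
  have PP : P *m P^T = 1%:M.
    rewrite trmx_mxsub trmx1 mulmx_colsub mulmx1 /P -mxsubcr.
    by apply/matrixP=> i j; rewrite !mxE (inj_eq f_inj).
  by rewrite -[v]mulmx1 -PP mulmxA vP0 mul0mx.
have := posS _ vP0; rewrite trmxK trmx_mul !mulmxA -(mulmxA v) -(mulmxA v).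
by rewrite -PSP vS mul0mx mxE ltxx.
Qed.

(** Cramer's rule: up to a nonzero factor the entry is the cofactor at the transposed position, so
    row [l] and column [k] are the ones removed. *)
Lemma invmx_eq0 (R : fieldType) (n : nat) (S : 'M[R]_n) (k l : 'I_n) :
  S \in unitmx -> (invmx S k l == 0) = (minor S [set~ l] [set~ k] == 0).
Proof.
move=> uS; rewrite /invmx uS !mxE mulf_eq0 invr_eq0.
rewrite unitmxE unitfE in uS; rewrite (negPf uS) /= /cofactor.
have im (i : 'I_n) : lift i @: [set: 'I_n.-1] = [set~ i].
  apply/setP=> x; rewrite !inE; apply/imsetP/idP => [[y _ ->]|].
    by rewrite eq_sym neq_lift.
  by rewrite eq_sym => /unlift_some[y -> _]; exists y; rewrite ?inE.
have [b ->] := minor_mxsub S (@lift_inj _ l) (@lift_inj _ k) (im l) (im k).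
rewrite !mulf_eq0 !signr_eq0 /=; congr (\det _ == 0).
by apply/matrixP=> i j; rewrite !mxE.
Qed.

Lemma minor_map (A B : comNzRingType) (f : {rmorphism A -> B}) (n : nat)
    (M : 'M[A]_n) (I J : {set 'I_n}) :
  f (minor M I J) = minor (map_mx f M) I J.
Proof. by rewrite /minor -det_map_mx map_conform_mx map_mx0 map_mxsub. Qed.

Lemma setU1_setC2 (n : nat) (k l : 'I_n) :
  k != l -> k |: ~: [set k; l] = [set~ l].
Proof.
move=> kl; apply/setP=> x; rewrite !inE negb_or.
by have [->|] := eqVneq x k; rewrite ?kl.
Qed.

(** As [s] has no repetition the product is squarefree, so each of its variables need only occur in
    [m]. *)
Lemma mpolyX_prod_dvd (R : nzRingType) (N : nat) (m : 'X_{1..N}) (s : seq 'I_N) :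
  uniq s -> (forall v, v \in s -> m v != 0%N) ->
  exists c : {mpoly R[N]}, 'X_[m] = c * \prod_(v <- s) 'X_v.
Proof.
elim: s m => [|v s IH] m; first by exists 'X_[m]; rewrite big_nil mulr1.
move=> /=/andP[vs us] ms.
have le_vm : (U_(v) <= m)%MM.
  apply/mnm_lepP => u; rewrite mnm1E.
  by have [<-|] := eqVneq v u; rewrite ?lt0n ?ms ?mem_head.
have [|c Dc] := IH (m - U_(v))%MM us.
  move=> u us'; rewrite mnmBE mnm1E; have [vu|_] := eqVneq v u.
    by rewrite vu us' in vs.
  by rewrite subn0 ms // inE us' orbT.
by exists c; rewrite big_cons -commr_mpolyX mulrA -Dc -mpolyXD submK.
Qed.

(** * The generic matrix and its real specialisations *)

Section Sigma.
Variables (R : realType) (n : nat).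
Implicit Types (i j k l : 'I_n) (p : seq 'I_n).

Lemma sigma_id i : sigma R i i = 1.
Proof. by rewrite /sigma ltnn. Qed.

Lemma sigma_sym i j : sigma R i j = sigma R j i.
Proof. by rewrite /sigma; case: ltngtP. Qed.

Lemma sigmaX i j : i != j -> exists2 v : 'I_(nvars n), sigma R i j = 'X_v &
  val (enum_val v) = (i, j) \/ val (enum_val v) = (j, i).
Proof.
rewrite -val_eqE neq_ltn /sigma => /orP[ij|ji].
  rewrite ij; case: insubP => [u _ Du|]; last by rewrite ij.
  by exists (enum_rank u); rewrite // enum_rankK Du; left.
rewrite ltnNge ltnW //= ji; case: insubP => [u _ Du|]; last by rewrite ji.
by exists (enum_rank u); rewrite // enum_rankK Du; right.
Qed.

Lemma path_monomialE k p : path_monomial R k p = path_weight (Sigma R n) k p.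
Proof. by apply: eq_bigr => e _; rewrite mxE. Qed.

(** The first edge contains [k], which the rest of the path avoids, so its variable is new. The
    clause on endpoints carries this through the induction. *)
Lemma path_monomial_vars k p : uniq (k :: p) -> exists s : seq 'I_(nvars n),
  [/\ uniq s, path_monomial R k p = \prod_(v <- s) 'X_v & forall v, v \in s ->
    (val (enum_val v)).1 \in k :: p /\ (val (enum_val v)).2 \in k :: p].
Proof.
elim: p k => [|c p IH] k; first by exists [::]; rewrite /path_monomial !big_nil.
case/andP=> kp /IH[s [us Ds sp]].
have kc : k != c by apply: contraNneq kp => ->; rewrite mem_head.
have [v Dv vkc] := sigmaX kc; exists (v :: s); split=> /=.
- rewrite us andbT; apply: contra kp => /sp[].
  by case: vkc => -> /=.
- by rewrite path_monomialE path_weight_cons -path_monomialE Ds mxE Dv big_cons.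
move=> u /[!in_cons] /orP[/eqP->|/sp[u1 u2]].
  by case: vkc => -> /=; rewrite !eqxx ?orbT.
by split; apply/orP; right.
Qed.

Variable x : 'I_(nvars n) -> R.

Definition Sigma_at : 'M[R]_n := map_mx (meval x) (Sigma R n).

Lemma Sigma_atE i j : Sigma_at i j = (sigma R i j).@[x].
Proof. by rewrite !mxE. Qed.

Lemma Sigma_at_sym : Sigma_at^T = Sigma_at.
Proof. by apply/matrixP=> i j; rewrite mxE !Sigma_atE sigma_sym. Qed.

Lemma Sigma_at_id i : Sigma_at i i = 1.
Proof. by rewrite Sigma_atE sigma_id rmorph1. Qed.

Lemma eval_at_Sigma f : eval_at f Sigma_at = f.@[x].
Proof.
rewrite /eval_at; apply: meval_eq => v; rewrite Sigma_atE.
case Dv: (enum_val v) => [[i j] /= ij].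
rewrite /sigma ij; case: insubP => [u _ Du|]; last by rewrite ij.
rewrite mevalXU; congr x; apply: enum_val_inj; rewrite enum_rankK.
by apply: val_inj; rewrite Du Dv.
Qed.

Lemma path_weight_at k p : path_weight Sigma_at k p = (path_monomial R k p).@[x].
Proof.
rewrite /path_monomial rmorph_prod; apply: eq_bigr => e _; exact: Sigma_atE.
Qed.

End Sigma.

(** * The inclusions between the four ideals *)

Section Model.
Variables (R : realType) (n : nat) (G H : sgraph n).
Implicit Types (S : 'M[R]_n) (f : cpoly R n) (k l : 'I_n).

(** This turns evaluation into the ring morphism [meval x] and [S] into the image of [Sigma], so
    that minors commute with evaluation. *)
Lemma eval_atE S : S^T = S -> (forall i, S i i = 1) ->
  exists x, S = Sigma_at x /\ forall f, eval_at f S = f.@[x].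
Proof.
move=> symS diagS; pose x (v : 'I_(nvars n)) := eval_at 'X_v S.
have DS : S = Sigma_at x.
  apply/matrixP=> i j; rewrite Sigma_atE; have [->|ij] := eqVneq i j.
    by rewrite sigma_id rmorph1.
  have [v -> vij] := sigmaX R ij; rewrite mevalXU /x /eval_at mevalXU.
  by case: vij => -> //=; rewrite -[in LHS]symS mxE.
by exists x; split=> // f; rewrite [in LHS]DS eval_at_Sigma.
Qed.

Lemma posdefmx_unit S : posdefmx S -> S \in unitmx.
Proof.
move=> pdS; rewrite unitmxE unitfE; have := posdefmx_minor_neq0 [set: _] pdS.
have [b ->] := minor_mxsub S (@inj_id _) (@inj_id _) (imset_id _) (imset_id _).
by rewrite mxsub_id mulf_eq0 signr_eq0.
Qed.

Lemma principal_minors_prod_dvd (I : {set 'I_n}) :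
  exists c, principal_minors_prod R n = c * minor (Sigma R n) I I.
Proof. by rewrite /principal_minors_prod (bigD1 I) //= mulrC; eexists. Qed.

Lemma principal_minors_prod_eval S : posdefmx S -> (forall i, S i i = 1) ->
  eval_at (principal_minors_prod R n) S != 0.
Proof.
move=> pdS diagS; have [x [DS ->]] := eval_atE (proj1 pdS) diagS.
rewrite rmorph_prod; apply/prodf_neq0 => I _ /=.
by rewrite (minor_map (meval x)) -/(Sigma_at x) -DS posdefmx_minor_neq0.
Qed.

Lemma eval_atD f g S : eval_at (f + g) S = eval_at f S + eval_at g S.
Proof. exact: mevalD. Qed.

Lemma eval_atM f g S : eval_at (f * g) S = eval_at f S * eval_at g S.
Proof. exact: mevalM. Qed.

Lemma eval_atX f m S : eval_at (f ^+ m) S = eval_at f S ^+ m.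
Proof. exact: rmorphXn. Qed.

Lemma is_ideal_vanishing (M : set 'M[R]_n) : is_ideal (vanishing_ideal M).
Proof.
split=> [S _|f g If Ig S MS|f g Ig S MS]; first exact: meval0.
  by rewrite eval_atD If ?Ig ?addr0.
by rewrite eval_atM Ig ?mulr0.
Qed.

(** Principal minors are nonzero on the model, so powers of their product cancel pointwise. *)
Lemma saturation_vanishing f :
  saturation (vanishing_ideal (model1 R G H)) (principal_minors_prod R n) f ->
  vanishing_ideal (model1 R G H) f.
Proof.
move=> [m hf] S MS; have [pdS diagS _ _] := MS.
have /eqP := hf S MS.
rewrite eval_atM eval_atX mulf_eq0 expf_eq0.
by rewrite (negPf (principal_minors_prod_eval pdS diagS)) andbF => /eqP.
Qed.

Lemma minor_pairC (A : comNzRingType) (M : 'M[A]_n) k l : k != l ->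
  minor M (k |: ~: [set k; l]) (l |: ~: [set k; l]) = minor M [set~ l] [set~ k].
Proof.
by move=> kl; rewrite setU1_setC2 // [in X in l |: X]setUC setU1_setC2 // eq_sym.
Qed.

(** Exponents of [h] add up, so saturating twice yields nothing new and generators suffice. *)
Lemma saturation_gen_subset (S T : set (cpoly R n)) h f :
  (forall g, S g -> saturation (ideal_gen T) h g) ->
  saturation (ideal_gen S) h f -> saturation (ideal_gen T) h f.
Proof.
move=> ST [m Sf].
have [m' Tf] := ideal_gen_min (is_ideal_saturation h (is_ideal_gen T)) ST Sf.
by exists (m' + m)%N; rewrite exprD -mulrA.
Qed.

Lemma vanishing_nonedge i j :
  nonedge H i j -> vanishing_ideal (model1 R G H) (sigma R i j).
Proof.
move=> ij S [[symS _] diagS _ Sij].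
by have [x [DS ->]] := eval_atE symS diagS; rewrite -Sigma_atE -DS Sij.
Qed.

Lemma vanishing_minor k l : nonedge G k l ->
  vanishing_ideal (model1 R G H) (minor (Sigma R n) [set~ l] [set~ k]).
Proof.
move=> kl S [pdS diagS invS _].
have [x [DS ->]] := eval_atE (proj1 pdS) diagS.
rewrite (minor_map (meval x)) -/(Sigma_at x) -DS; apply/eqP.
by rewrite -invmx_eq0 ?posdefmx_unit // invS.
Qed.

(** Take for [C] the complement of [[set k; l]]: it separates, because a path between nonadjacent
    vertices has an interior vertex. *)
Lemma SCI_subset_CI f : SCI R G H f -> CI R G H f.
Proof.
apply: saturation_gen_subset => _ [[i [j [ij ->]]]|[k [l [kl ->]]]];
  apply/mem_saturation/mem_ideal_gen; [by left; exists i, j | right].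
have [kl' nGkl] := andP kl.
exists k, l, (~: [set k; l]); split=> //; last by rewrite minor_pairC.
move=> p /and4P[_ Gp lp up].
case: p Gp lp up => [_ /= /eqP Dk|c p /=/andP[kc _] lp /andP[kp _]].
  by rewrite Dk eqxx in kl'.
exists c; first by rewrite !inE eqxx orbT.
rewrite !inE negb_or; apply/andP; split.
  by apply: contraNneq kp => ->; rewrite mem_head.
by apply: contraNneq nGkl => <-.
Qed.

Lemma path_ideal_subset_SCI f :
  (forall (k l : 'I_n) (p q : seq 'I_n), nonedge G k l ->
    is_path H k l p -> is_path H k l q -> p = q) ->
  path_ideal R G H f -> SCI R G H f.
Proof.
move=> one_path; have idS : is_ideal (SCI R G H).
  exact/is_ideal_saturation/is_ideal_gen.
have nonedgeS i j : nonedge H i j -> SCI R G H (sigma R i j).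
  by move=> ij; apply/mem_saturation/mem_ideal_gen; left; exists i, j.
move: f; apply: ideal_gen_min => // _ [[i [j [ij ->]]]|[k [l [p [pp kl ->]]]]].
  exact: nonedgeS.
have [kl' _] := andP kl.
rewrite path_monomialE -[path_weight _ _ _]mul1r.
apply: (@path_weight_in_ideal _ _ H _ _ idS _ k l (~: [set k; l])) => //.
- by move=> i j ij; rewrite mxE; apply: nonedgeS.
- move=> D x; have [c Dh] := principal_minors_prod_dvd D.
  exact: saturation_dvdK (is_ideal_gen _) Dh.
- by rewrite !inE eqxx.
- by rewrite !inE eqxx orbT.
- move=> x xp; rewrite !inE negb_or; case/and4P: pp => _ _ _ /andP[kp _].
  have -> /= : x != k by apply: contraNneq kp => <-.
  by rewrite orbN.
- by move=> q Hq _; apply: one_path Hq pp.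
rewrite mul1r minor_pairC //; apply/mem_saturation/mem_ideal_gen.
by right; exists k, l.
Qed.

(** The path expansion takes place inside the vanishing ideal, which contains the nonedges of [H]
    and, by assumption, the path monomials. *)
Lemma CI_subset_vanishing f :
  (forall g, path_ideal R G H g -> vanishing_ideal (model1 R G H) g) ->
  CI R G H f -> vanishing_ideal (model1 R G H) f.
Proof.
move=> PV [m CIf]; apply: saturation_vanishing; exists m; move: CIf.
apply: ideal_gen_min; first exact: is_ideal_vanishing.
move=> _ [[i [j [ij ->]]]|[k [l [C [kl kC _ ->]]]]]; first exact: vanishing_nonedge.
have [kl' _] := andP kl.
have [kC' lC'] : k \notin C /\ l \notin C.
  by split; apply/negP => /(fintype.subsetP kC); rewrite !inE eqxx ?orbT.
rewrite -[minor _ _ _]mul1r; apply: (minor_in_path_ideal (H := H)) => //.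
- exact: is_ideal_vanishing.
- by move=> i j ij; rewrite mxE; apply: vanishing_nonedge.
move=> p pp _; rewrite mul1r -path_monomialE; apply: PV.
by apply: mem_ideal_gen; right; exists k, l, p.
Qed.

Lemma vanishing_subset_path_ideal f :
  vanishing_ideal (model1 R G H) f -> path_ideal R G H f.
Proof.
move=> Vf; have idP : is_ideal (path_ideal R G H) by apply: is_ideal_gen.
have [_ _ PM] := idP.
rewrite [f]mpolyE big_seq; elim/big_ind: _ => [||m mf]; try by case: idP.
rewrite -mul_mpolyC; apply: (PM).
(* The choice 1 / (n + 1) gives [e * n%:R < 1], as [posdefmx_near1] requires. *)
apply: contrapT => nPm; pose e : R := n.+1%:R^-1.
have e0 : 0 < e by rewrite invr_gt0.
have [x [xe xm fx]] := mpoly_nonzero_near0 e0 mf.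
(* If such a monomial were nonzero at [x], all its variables would occur in [m]; it would then
   divide ['X_[m]] and put it into the path ideal. *)
have monE s : uniq s -> path_ideal R G H (\prod_(v <- s) 'X_v) ->
    (\prod_(v <- s) 'X_v : cpoly R n).@[x] = 0.
  move=> us Ps; apply/eqP; apply/contraT => xs0; case: nPm.
  have [v vs|c ->] := mpolyX_prod_dvd R us (m := m); last exact: PM.
  apply: xm; apply: contraNneq xs0 => xv.
  by rewrite (big_rem v) //= mevalM mevalXU xv mul0r.
have nonedge0 i j : nonedge H i j -> Sigma_at x i j = 0.
  move=> ij; have [ij' _] := andP ij.
  rewrite Sigma_atE; have [v Dv _] := sigmaX R ij'.
  have := monE [:: v] isT; rewrite big_seq1 -Dv; apply.
  by apply: mem_ideal_gen; left; exists i, j.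
have pdS : posdefmx (Sigma_at x).
  apply: (@posdefmx_near1 _ _ _ e); rewrite ?ltW ?Sigma_at_sym //.
  - exact: Sigma_at_id.
  - by rewrite mulrC ltr_pdivrMr // mul1r ltr_nat.
  move=> i j ij; rewrite Sigma_atE; have [v -> _] := sigmaX R ij.
  by rewrite mevalXU; have /andP[x0 /ltW xle] := xe v; rewrite ger0_norm.
case/eqP: fx; rewrite -eval_at_Sigma; apply: Vf; split=> //.
  exact: Sigma_at_id.
move=> k l kl; have [kl' _] := andP kl; apply/eqP.
rewrite invmx_eq0 ?posdefmx_unit // -minor_pairC // -[minor _ _ _]mul1r.
(* The path expansion is applied to the real matrix [Sigma_at x] with the zero ideal: all relevant
   path weights are 0, hence so is the minor. *)
have id0 : is_ideal (fun y : R => y = 0).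
  by split=> // [y z -> ->|y z ->]; rewrite ?addr0 ?mulr0.
apply/eqP/(minor_in_path_ideal id0 nonedge0); rewrite ?inE ?eqxx ?orbT //.
move=> p pp _; rewrite mul1r path_weight_at.
have /and4P[_ _ _ up] := pp.
have [s [us Ds _]] := path_monomial_vars R up.
rewrite Ds; apply: monE => //; rewrite -Ds.
by apply: mem_ideal_gen; right; exists k, l, p.
Qed.

End Model.

Theorem theorem3p20 (R : realType) (n : nat) (G H : sgraph n)
    (one_path : forall (k l : 'I_n) (p q : seq 'I_n), nonedge G k l ->
      is_path H k l p -> is_path H k l q -> p = q) :
  [/\ SCI R G H = CI R G H,
      CI R G H = vanishing_ideal (model1 R G H)
    & vanishing_ideal (model1 R G H) = path_ideal R G H].
Proof.
have PS := path_ideal_subset_SCI one_path.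
have SV f : SCI R G H f -> vanishing_ideal (model1 R G H) f.
  move=> [m SCIf]; apply: saturation_vanishing; exists m; move: SCIf.
  apply: ideal_gen_min; first exact: is_ideal_vanishing.
  by move=> _ [[i [j [ij ->]]]|[k [l [kl ->]]]];
    [apply: vanishing_nonedge | apply: vanishing_minor].
(* The inclusion of the path ideal in the vanishing ideal is obtained through [SCI]. *)
have CV f := @CI_subset_vanishing R n G H f (fun g Pg => SV g (PS R g Pg)).
have VP f := @vanishing_subset_path_ideal R n G H f.
split; apply/seteqP; split=> f.
- exact: SCI_subset_CI.
- by move=> /CV/VP/PS.
- exact: CV.
- by move=> /VP/PS/SCI_subset_CI.
- exact: VP.
- by move=> /PS/SV.
Qed.
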